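(* Let $K$ be a field of characteristic $p>0$, and suppose that $K$ is transcendental (i.e. not algebraic) over $\mathbb{F}_p$. Then $K$ is separably closed if and only if, for all coprime irreducible polynomials $f,g$ of $K[X]$, the set $G_0(K[X])$ of units of $K[X]$ is contained in the closure of $\mathrm{pow}(g)$ in the $(f)$-topology.
   Context: For a ring $R$ with group of units $U(R)$ and $a\in R$, $\mathrm{pow}(a):=\{ua^n \mid u\in U(R),\ n\geq 1\}$. $G_0(R)$ denotes the set of units of $R$; thus $G_0(K[X])=K\setminus\{0\}$. For a prime ideal $P$ of $R=K[X]$, the $P$-topology is the topology on the set $R\setminus P$ generated by the sets $a+P^n$ for $a\in R\setminus P$ and $n\geq 1$; the $(f)$-topology is the $P$-topology for $P=(f)=fK[X]$. *)

(* Defs.v *)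
From HB Require Import structures.
From mathcomp Require Import all_boot all_order all_algebra all_field.
From mathcomp Require Import mathcomp_extra boolp classical_sets topology_structure.

Set Implicit Arguments.
Unset Strict Implicit.
Unset Printing Implicit Defensive.

Import GRing.Theory.
Local Open Scope classical_set_scope.
Local Open Scope ring_scope.

Definition G0 (R : unitRingType) : set R := [set u | u \is a GRing.unit].

Definition pow (R : unitRingType) (a : R) : set R :=
  [set x | exists u n, [/\ G0 u, (1 <= n)%N & x = u * a ^+ n]].

Definition ideal_mul (R : comNzRingType) (I J : set R) : set R :=
  [set x | exists (m : nat) (a b : 'I_m -> R),
     [/\ forall i, I (a i), forall i, J (b i) & x = \sum_(i < m) a i * b i]].

Definition ideal_exp (R : comNzRingType) (P : set R) (n : nat) : set R :=
  iter n (ideal_mul P) setT.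

Definition principal_ideal (R : comNzRingType) (f : R) : set R :=
  [set f * h | h in [set: R]].

(* The set R \ P as a type of its own, so that it can carry the P-topology
   (the definition makes sense for any subset P; it is used for prime ideals). *)
Definition Pspace (R : comNzRingType) (P : set R) : Type := {x : R | x \in ~` P}.

Section PTopology.
Variables (R : comNzRingType) (P : set R).

HB.instance Definition _ := SubChoice.on (Pspace P).

Definition P_basic (A : set (Pspace P)) : Prop :=
  exists (a : R) (n : nat), [/\ ~ P a, (1 <= n)%N &
    A = [set x | exists2 y, ideal_exp P n y & val x = a + y]].

HB.instance Definition _ :=
  @isSubBaseTopological.Build (Pspace P) (set (Pspace P)) P_basic id.

End PTopology.

(* Closure in R \ P of the trace of A on R \ P, viewed as a subset of R. *)
Definition P_closure (R : comNzRingType) (P A : set R) : set R :=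
  [set val x | x in closure [set x : Pspace P | A (val x)]].

(* The inclusion of the prime field F_p in K, when K has characteristic p. *)
Definition Fp_embed (K : fieldType) (p : nat) (a : 'F_p) : K := (a : nat)%:R.

Definition algebraic_over_Fp (K : fieldType) (p : nat) : Prop :=
  forall x : K, algebraicOver (@Fp_embed K p) x.

Definition separably_closed (K : fieldType) : Prop :=
  forall q : {poly K}, separable_poly q ->
    exists s : seq K, q %= \prod_(a <- s) ('X - a%:P).

(* Main.v *)
(** The closure condition for [(f, g)] says that modulo every [f ^ n] some power of
    [g] is a constant; since [x |-> x ^ (p ^ k)] is additive, [n = 1] suffices.
    If [K] is separably closed, then [f] is of degree one in [X ^ (p ^ k)] for some
    [k], so [g ^ (p ^ k)] is constant modulo [f].
    Conversely, suppose that [f] is irreducible and separable with two distinct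
    roots [a], [b] in an extension of [K]. Taking [g = X - s], some power of
    [(a - s) / (b - s)] is 1 for every [s] in [K]. With [s = 0] and [s = 1] this
    makes [a] and [b] algebraic over [F_p], and then every [s] in [K] is algebraic
    over [F_p]. *)

Require Import Defs.
From HB Require Import structures.
From mathcomp Require Import all_boot all_order all_algebra all_field.
From mathcomp Require Import finmap boolp ring.
From mathcomp Require Import classical_sets topology_structure.

Import GRing.Theory.
Local Open Scope classical_set_scope.
Local Open Scope ring_scope.

(** * Powers of a principal ideal and the neighbourhoods they define *)

Lemma ideal_exp_principal (R : comNzRingType) (f : R) (n : nat) :
  ideal_exp (principal_ideal f) n = principal_ideal (f ^+ n).
Proof.
elim: n => [|n IHn]; apply/seteqP; split=> x //.
- by move=> _; exists x; rewrite ?expr0 ?mul1r.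
- rewrite /ideal_exp iterS -/(ideal_exp _ n) IHn => -[m [a [b [fa fb ->]]]].
  apply: (big_ind (principal_ideal (f ^+ n.+1))).
  + by exists 0; rewrite ?mulr0.
  + by move=> _ _ [y _ <-] [z _ <-]; exists (y + z); rewrite ?mulrDr.
  + move=> i _; have [[y _ <-] [z _ <-]] := (fa i, fb i).
    by exists (y * z) => //; rewrite exprS mulrACA.
- rewrite /ideal_exp iterS -/(ideal_exp _ n) IHn => -[h _ <-].
  exists 1%N, (fun=> f), (fun=> f ^+ n * h); split.
  + by move=> _; exists 1; rewrite ?mulr1.
  + by move=> _; exists h.
  + by rewrite big_ord1 exprS mulrA.
Qed.

Lemma principal_ideal_exp_le (R : comNzRingType) (f : R) (m n : nat) :
  (m <= n)%N -> principal_ideal (f ^+ n) `<=` principal_ideal (f ^+ m).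
Proof.
move=> /subnKC <- _ [h _ <-]; exists (f ^+ (n - m) * h) => //.
by rewrite exprD mulrA.
Qed.

(** Any point of a coset of [f ^+ m] can serve as its centre, so a subbasic set containing [x]
    contains the coset of [x] itself. For a finite intersection the largest of the exponents
    works. *)
Lemma nbhs_principal (R : comNzRingType) (f : R)
    (x : Pspace (principal_ideal f)) (B : set (Pspace (principal_ideal f))) :
  nbhs x B -> exists n, [/\ (1 <= n)%N &
    forall y, principal_ideal (f ^+ n) (val y - val x) -> B y].
Proof.
rewrite nbhsE => -[A [[S basicS <-] [C SC Cx]] subB].
have [T basicT TC] := basicS _ SC.
have [n [n_gt0 nP]] : exists n, [/\ (1 <= n)%N &
    forall y, principal_ideal (f ^+ n) (val y - val x) -> C y]; last first.
  by exists n; split=> // y /nP Cy; apply: subB; exists C.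
rewrite -TC in Cx *.
suff [n [n_gt0 nP]] : exists n, [/\ (1 <= n)%N & forall i, i \in enum_fset T ->
    forall y, principal_ideal (f ^+ n) (val y - val x) -> i y].
  by exists n; split=> // y xy i Ti; apply: nP xy.
have : forall i, i \in enum_fset T -> @P_basic R (principal_ideal f) i /\ i x.
  by move=> i Ti; split; [have := basicT _ Ti; rewrite inE | apply: Cx].
elim: (enum_fset T) => [|i s IHs] sP; first by exists 1%N; split.
have [|n [n_gt0 nP]] := IHs; first by move=> j js; apply: sP; rewrite inE js orbT.
have [[a [m [_ m_gt0 Di]]] ix] := sP i (mem_head _ _).
exists (maxn n m); split=> [|j]; first by rewrite leq_max n_gt0.
rewrite inE => /predU1P[->|js] y xy; last first.
  by apply: nP js _ _; apply: principal_ideal_exp_le xy; apply: leq_maxl.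
(* Recentring: [x] is [a + f ^+ m * h] and [y] is [x + f ^+ m * k], so [y] lies in the coset of
   [a]. *)
move: ix; rewrite Di /= ideal_exp_principal => -[_ [h _ <-] Dx].
have [k _ Dy] := principal_ideal_exp_le _ _ _ _ (leq_maxr n m) _ xy.
exists (f ^+ m * (h + k)); first by exists (h + k).
by rewrite mulrDr Dy addrA -Dx addrC subrK.
Qed.

(** * Closure of [pow g] and congruences between powers of [g] and constants *)

Lemma principal_idealP (K : fieldType) (f g : {poly K}) :
  principal_ideal f g <-> f %| g.
Proof.
split=> [[h _ <-]|/dvdpP[h ->]]; first exact: dvdp_mulr.
by exists h; rewrite // mulrC.
Qed.

(** If [g ^+ m] is congruent to [c] modulo [f ^+ n], then [d / c * g ^+ m] is an element of [pow g]
    congruent to the unit [d]. Coprimality of [f] and [g] forces [c] to be nonzero and keeps this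
    element outside the ideal of [f]. *)
Lemma G0_poly_subset_closure (K : fieldType) (f g : {poly K}) :
    irreducible_poly f -> coprimep f g ->
    (forall n, exists m (c : K), (1 <= m)%N /\ f ^+ n %| g ^+ m - c%:P) ->
  @G0 {poly K} `<=` P_closure (principal_ideal f) (pow g).
Proof.
move=> irr_f co_fg powg d Ud.
have unit_ndvd (u : {poly K}) : u \is a GRing.unit -> ~~ (f %| u).
  rewrite poly_unitE => /andP[/eqP size_u _]; apply/negP=> /dvdp_leq.
  rewrite -size_poly_gt0 size_u => /(_ isT); rewrite leqNgt.
  by case: irr_f => ->.
have dP : d \in ~` principal_ideal f.
  by rewrite inE => /principal_idealP; apply/negP/unit_ndvd.
exists (exist _ d dP : Pspace (principal_ideal f)) => //.
move=> B /nbhs_principal[n [n_gt0 nP]].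
have [m [c [m_gt0 fgc]]] := powg n.
have fgc1 : f %| g ^+ m - c%:P.
  by apply: dvdp_trans fgc; rewrite -{1}[f]expr1 dvdp_exp2l.
have nfg : ~~ (f %| g ^+ m).
  by rewrite -irreducible_poly_coprime // coprimep_expr.
have c_neq0 : c != 0.
  by apply: contraNneq nfg => c0; move: fgc1; rewrite c0 subr0.
have Uc : c%:P \is a GRing.unit.
  by rewrite poly_unitE size_polyC coefC eqxx unitfE c_neq0.
have Uu : d * c%:P^-1 \is a GRing.unit by rewrite unitrM Ud unitrV.
have xP : d * c%:P^-1 * g ^+ m \in ~` principal_ideal f.
  rewrite inE => /principal_idealP; apply/negP.
  rewrite -irreducible_poly_coprime // coprimepMr !irreducible_poly_coprime //.
  by rewrite unit_ndvd.
exists (exist _ (d * c%:P^-1 * g ^+ m) xP : Pspace (principal_ideal f)); split.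
  by exists (d * c%:P^-1), m.
apply: nP; apply/principal_idealP => /=.
have -> : d * c%:P^-1 * g ^+ m - d = d * c%:P^-1 * (g ^+ m - c%:P).
  by rewrite mulrBr divrK.
exact: dvdp_mull.
Qed.

(** It is enough to approximate the unit 1 modulo [f]: if [u * g ^+ m] is congruent to 1, then [u]
    is a nonzero constant and [g ^+ m] is congruent to its inverse. *)
Lemma closure_pow_const (K : fieldType) (f g : {poly K}) :
    @G0 {poly K} `<=` P_closure (principal_ideal f) (pow g) ->
  exists m (c : K), (1 <= m)%N /\ f %| g ^+ m - c%:P.
Proof.
move=> /(_ 1 (unitr1 _)) [x clx x1].
have nf1 : ~ principal_ideal f 1.
  by rewrite -x1; have := valP x; rewrite inE.
(* The coset of 1 modulo [f] is subbasic because its centre 1 lies outside the ideal. *)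
pose B := [set y : Pspace (principal_ideal f) |
  exists2 z, ideal_exp (principal_ideal f) 1 z & val y = 1 + z].
have nbB : nbhs x B.
  rewrite nbhsE; exists B => //; split; last first.
    exists 0; last by rewrite x1 addr0.
    by rewrite ideal_exp_principal; exists 0; rewrite ?mulr0.
  have oB : finI_from (@P_basic _ (principal_ideal f)) id B.
    by apply: finI_from1; exists 1, 1%N.
  by exists [set B]; [move=> _ -> | rewrite bigcup_set1].
have [y [[u [m [Uu m_gt0 Dy]]] [z]]] := clx _ nbB.
rewrite ideal_exp_principal expr1 => /principal_idealP fz; rewrite Dy => Dz.
move: Uu; rewrite /G0 /= poly_unitE => /andP[/eqP size_u Uu].
have [c c_neq0 Du] : exists2 c, c != 0 & u = c%:P.
  exists u`_0; first by rewrite -unitfE.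
  by apply: size1_polyC; rewrite size_u.
exists m, c^-1; split=> //.
suff -> : g ^+ m - (c^-1)%:P = (c^-1)%:P * z by apply: dvdp_mull.
have -> : z = u * g ^+ m - 1 by rewrite Dz addrC addKr.
by rewrite Du mulrBr mulrA -polyCM mulVf // mul1r mulr1.
Qed.

(** * Irreducible polynomials over a separably closed field of characteristic [p] *)

Lemma irreducible_factor (K : fieldType) (q : {poly K}) :
  (1 < size q)%N -> exists2 f, irreducible_poly f & f %| q.
Proof.
have [n] := ubnP (size q); elim: n q => // n IHn q ltqn q_gt1.
have [irr_q|nirr_q] := pselect (irreducible_poly q); first by exists q.
have [r [size_r rq nqr]] : exists r : {poly K}, [/\ size r != 1, r %| q & ~~ (r %= q)].
  apply: contrapT => nex; apply: nirr_q; split=> // r size_r rq.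
  by apply: contrapT => /negP nrq; apply: nex; exists r.
have q_neq0 : q != 0 by rewrite -size_poly_gt0 ltnW.
have r_neq0 : r != 0 by apply: contraNneq q_neq0 => r0; rewrite -dvd0p -r0.
have ltrq : (size r < size q)%N.
  rewrite ltn_neqAle (dvdp_leq q_neq0 rq) andbT.
  by apply: contra nqr => /eqP Dsize; rewrite -dvdp_size_eqp // Dsize.
have [||f irr_f fr] := IHn r; first exact: leq_trans ltrq ltqn.
  by rewrite ltn_neqAle eq_sym size_r size_poly_gt0.
by exists f => //; apply: dvdp_trans rq.
Qed.

(** Frobenius is additive, so [h] is [g] with its coefficients raised to the power [p]. *)
Lemma expp_comp_Xp (K : fieldType) (p : nat) (hp : p \in [pchar K]) (g : {poly K}) :
  exists h, g ^+ p = h \Po 'X^p.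
Proof.
have hP : [pchar {poly K}].-nat p.
  by rewrite pnatE ?(pcharf_prime hp) // pchar_poly.
elim/poly_ind: g => [|g c [h Dg]].
  by exists 0; rewrite comp_poly0 expr0n gtn_eqF ?prime_gt0 ?(pcharf_prime hp).
exists (h * 'X + (c ^+ p)%:P).
rewrite exprDn_pchar // exprMn Dg comp_polyD comp_polyM comp_polyX comp_polyC.
by rewrite rmorphXn.
Qed.

(** A zero derivative means that [i] times the [i]-th coefficient vanishes, which kills every
    coefficient whose index is prime to [p]. *)
Lemma deriv_eq0_comp_Xp (K : fieldType) (p : nat) (hp : p \in [pchar K])
    (f : {poly K}) :
  f^`() = 0 -> exists F, f = F \Po 'X^p.
Proof.
have p_gt0 := prime_gt0 (pcharf_prime hp).
move=> f'0; exists (\poly_(i < size f) f`_(i * p)); apply/polyP=> i.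
rewrite coef_comp_poly_Xn // coef_poly.
case: ifP => [pi|npi].
  rewrite divnK //; case: ltnP => // le_f; rewrite nth_default //.
  exact: leq_trans le_f (leq_div _ _).
case: i npi => [|i npi]; first by rewrite dvdn0.
have /eqP := congr1 (fun q : {poly K} => q`_i) f'0.
rewrite coef_deriv coef0 -mulr_natr mulf_eq0 -(dvdn_pcharf hp) npi orbF.
by move/eqP.
Qed.

Lemma separably_closed_size (K : fieldType) (f : {poly K}) :
    separably_closed K -> irreducible_poly f -> separable_poly f ->
  size f = 2%N.
Proof.
move=> scK irr_f /scK[[|a s] Df].
  by have := eqp_size Df; rewrite big_nil size_poly1; case: irr_f => /[swap] _ /[swap] ->.
have af : 'X - a%:P %| f by rewrite (eqp_dvdr _ Df) big_cons dvdp_mulr.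
by rewrite -(eqp_size (apply_irredp irr_f _ af)) size_XsubC.
Qed.

(* Reducing mod [f], this says that [K[X]/f] is purely inseparable over [K]. *)
Lemma separably_closed_pow_const (K : fieldType) (p : nat) (hp : p \in [pchar K])
    (f g : {poly K}) :
    separably_closed K -> irreducible_poly f ->
  exists k (c : K), f %| g ^+ (p ^ k) - c%:P.
Proof.
move=> scK; have p_gt1 := prime_gt1 (pcharf_prime hp).
have [n] := ubnP (size f); elim: n f g => // n IHn f g ltfn irr_f.
have f_neq0 := irredp_neq0 irr_f.
(* If the derivative is nonzero, [f] is separable, hence of degree one, and [g] is already constant
   modulo [f]. *)
have [f'0|f'_neq0] := eqVneq f^`() 0; last first.
  have sep_f : separable_poly f.
    rewrite unlock irreducible_poly_coprime //.
    apply: contra_neqN f'_neq0 => /dvdp_leq le_f.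
    by apply: contraTeq (lt_size_deriv f_neq0) => /le_f; rewrite -leqNgt.
  have size_f := separably_closed_size _ _ scK irr_f sep_f.
  exists 0%N, (g %% f)`_0; rewrite expn0 expr1 -size1_polyC.
    by rewrite {1}(divp_eq g f) addrK dvdp_mull.
  by rewrite -ltnS -size_f ltn_modp.
have [F Df] := deriv_eq0_comp_Xp _ _ hp _ f'0.
have [h Dg] := expp_comp_Xp _ _ hp g.
have F_gt1 : (1 < size F)%N.
  rewrite ltnNge; apply: contraL (irr_f.1) => /size1_polyC DF.
  by rewrite Df DF comp_polyC -leqNgt size_polyC leq_b1.
have F_neq0 : F != 0 by rewrite -size_poly_gt0 ltnW.
(* Predecessors of sizes are degrees: substituting ['X^p] multiplies them by [p]. *)
have size_comp (r : {poly K}) : (size (r \Po 'X^p)).-1 = ((size r).-1 * p)%N.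
  by rewrite size_comp_poly size_polyXn.
have ltF : (size F < size f)%N.
  have := size_comp F; rewrite -Df; have := irr_f.1; move: F_gt1.
  case: (size F) (size f) => [|[|u]] // [|[|v]] //= _ _ ->.
  by rewrite !ltnS -{1}[u.+1]muln1 ltn_pmul2l.
(* A nonconstant factor [r] of [F] gives the factor [r \Po 'X^p] of [f], which must have the degree
   of [f]; dividing degrees by [p], [r] has the degree of [F]. *)
have irr_F : irreducible_poly F.
  split=> // r size_r rF.
  have r_neq0 : r != 0 by apply: contraNneq F_neq0 => r0; rewrite -dvd0p -r0.
  have /dvdpP[s Ds] := rF.
  have rf : r \Po 'X^p %| f by rewrite Df Ds comp_polyM dvdp_mull.
  have size_rX : size (r \Po 'X^p) != 1.
    have r_gt1 : (1 < size r)%N by rewrite ltn_neqAle eq_sym size_r size_poly_gt0.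
    apply/eqP=> size_rX; have := size_comp r; rewrite size_rX => /esym/eqP.
    by rewrite muln_eq0 -subn1 subn_eq0 leqNgt r_gt1 gtn_eqF // ltnW.
  have := eqp_size (irr_f.2 _ size_rX rf) => /(congr1 predn).
  rewrite Df !size_comp => /eqP; rewrite eqn_pmul2r ?(ltnW p_gt1) // => /eqP Dsize.
  rewrite -dvdp_size_eqp // -(prednK (_ : 0 < size r)%N) ?size_poly_gt0 //.
  by rewrite Dsize prednK ?size_poly_gt0.
have [||k [c Fh]] := IHn F h; [exact: leq_trans ltF ltfn | by [] |].
(* Substituting ['X^p] turns [h] into [g ^+ p] and [F] into [f], at the cost of one more factor [p]
   in the exponent. *)
exists k.+1, c; have /dvdpP[s Ds] := Fh.
have /(congr1 (fun q => q \Po 'X^p)) := Ds.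
rewrite comp_polyM -Df comp_polyB comp_polyC (rmorphXn (comp_poly _)) /= -Dg.
by rewrite -exprM -expnS => ->; apply: dvdp_mull.
Qed.

(** * Algebraicity from roots of unity *)

Lemma unity_algebraic (F E : fieldType) (e : {rmorphism F -> E}) (z : E) (m : nat) :
  (0 < m)%N -> z ^+ m = 1 -> algebraicOver e z.
Proof.
move=> m_gt0 zm; exists ('X^m - 1); first by rewrite -size_poly_gt0 size_XnsubC.
by rewrite rmorphB rmorph1 /= map_polyXn /root !hornerE zm subrr.
Qed.

(** Each ratio [(a - s) / (b - s)] is a root of unity other than 1. The linear equations for [s = 0]
    and [s = 1] determine [b] from two such ratios, and the one for [s = t] then determines [t]. *)
Lemma algebraic_of_shifted_powers (F E : fieldType) (e : {rmorphism F -> E})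
    (a b t : E) :
    a != b ->
    (forall s, s \in [:: 0; 1; t] ->
      exists2 m, (0 < m)%N & (a - s) ^+ m = (b - s) ^+ m) ->
  algebraicOver e t.
Proof.
move=> neq_ab pow_ab.
have zP s : s \in [:: 0; 1; t] ->
    exists z, [/\ algebraicOver e z, z != 1 & a - s = z * (b - s)].
  move=> /pow_ab[m m_gt0 Em].
  have bs_neq0 : b - s != 0.
    apply: contraNneq neq_ab => bs0; move: Em; rewrite bs0 expr0n gtn_eqF //.
    by move/eqP; rewrite expf_eq0 m_gt0 /= -bs0 => /eqP/addIr ->.
  exists ((a - s) / (b - s)); split; last by rewrite divfK.
    apply: (unity_algebraic _ _ _ _ m) => //.
    by rewrite expr_div_n Em divff // expf_neq0.
  apply: contra neq_ab => /eqP /(congr1 ( *%R^~ (b - s))).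
  by rewrite divfK // mul1r => /addIr ->.
have [|z0 [alg0 _ D0]] := zP 0; first by rewrite !inE eqxx.
have [|z1 [alg1 z1_neq1 D1]] := zP 1; first by rewrite !inE eqxx orbT.
have [|z [algz z_neq1 Dz]] := zP t; first by rewrite !inE eqxx !orbT.
rewrite !subr0 in D0; rewrite D0 in D1 Dz.
(* Equal ratios would turn [z0 * b - 1 = z1 * (b - 1)] into [z1 = 1]. *)
have z01 : z0 - z1 != 0.
  rewrite subr_eq0; apply: contraNneq z1_neq1 => z01; move: D1; rewrite z01.
  by rewrite mulrBr mulr1 => /addrI/oppr_inj ->.
have algb : algebraicOver e b.
  have -> : b = (1 - z1) / (z0 - z1).
    apply: (mulIf z01); rewrite divfK //.
    have /eqP := D1; rewrite -subr_eq0 => /eqP D; apply/eqP; rewrite -subr_eq0 -D.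
    by apply/eqP; ring.
  by apply: algebraic_div; apply: algebraic_sub => //; apply: algebraic1.
have z_1 : z - 1 != 0 by rewrite subr_eq0.
have -> : t = (z * b - z0 * b) / (z - 1).
  apply: (mulIf z_1); rewrite divfK //.
  have /eqP := Dz; rewrite -subr_eq0 => /eqP D; apply/eqP; rewrite -subr_eq0 -D.
  by apply/eqP; ring.
apply: algebraic_div; apply: algebraic_sub => //; try exact: algebraic_mul.
exact: algebraic1.
Qed.

(** * Two distinct roots in an extension field *)

Lemma size_mulXsubC (R : idomainType) (f : {poly R}) (a : R) :
  f != 0 -> size (f * ('X - a%:P)) = (size f).+1.
Proof. by move=> f_neq0; rewrite size_mul ?polyXsubC_eq0 // size_XsubC addn2. Qed.

(** Adjoin a root [a] and split off its linear factor. The cofactor [h] is nonconstant, and by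
    separability it does not vanish at [a], so a root of [h] adjoined in a second step differs from
    [a]. *)
Lemma irreducible_separable_two_roots (K : fieldType) (f : {poly K}) :
    irreducible_poly f -> separable_poly f -> (2 < size f)%N ->
  exists (E : fieldType) (i : {rmorphism K -> E}) (a b : E),
    [/\ a != b, root (map_poly i f) a & root (map_poly i f) b].
Proof.
move=> irr_f sep_f f_gt2.
have [L _ [a ra _]] := irredp_FAdjoin irr_f.
have /factor_theorem[h Dh] := ra.
have sep_h : separable_poly (h * ('X - a%:P)) by rewrite -Dh separable_map.
move: sep_h; rewrite separable_root => /andP[_ nra].
have h_gt1 : (1 < size h)%N.
  have := size_map_poly (in_alg L) f; rewrite Dh size_mulXsubC.
    by move=> Dsize; rewrite -ltnS Dsize.
  by apply: contraNneq nra => ->; rewrite root0.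
have [h1 irr_h1 /dvdpP[h2 Dh2]] := irreducible_factor _ _ h_gt1.
have [M _ [b rb _]] := irredp_FAdjoin irr_h1.
have rhb : root (map_poly (in_alg M) h) b.
  by rewrite Dh2 rmorphM /= rootM rb orbT.
exists M, (in_alg M \o in_alg L), (in_alg M a), b.
rewrite map_poly_comp fmorph_root ra Dh rmorphM /= rootM rhb; split=> //.
by apply: contraNneq nra => Db; rewrite -(fmorph_root (in_alg M)) /= Db.
Qed.

(** * The prime field, splitting of separable polynomials, and the equivalence *)

Lemma Fp_embed_rmorphism (K : fieldType) (p : nat) (hp : p \in [pchar K]) :
  exists e : {rmorphism 'F_p -> K}, @Fp_embed K p =1 e.
Proof.
have pr_p := pcharf_prime hp.
have modE n : (n %% p)%:R = n%:R :> K.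
  by rewrite {2}(divn_eq n p) natrD natrM (pcharf0 hp) mulr0 add0r.
(* The modulus built into ['F_p] agrees with [p] only because [p] is prime; [Fp_cast] makes the
   identification. *)
have FpD (x y : 'F_p) : (x + y : 'F_p) = ((x + y)%N %% p)%N :> nat.
  by congr (_ %% _)%N; apply: Fp_cast.
have FpM (x y : 'F_p) : (x * y : 'F_p) = ((x * y)%N %% p)%N :> nat.
  by congr (_ %% _)%N; apply: Fp_cast.
have addE : GRing.nmod_morphism (@Fp_embed K p).
  by split=> [|x y]; rewrite /Fp_embed ?FpD ?modE ?natrD.
have mulE : GRing.monoid_morphism (@Fp_embed K p).
  by split=> [|x y]; rewrite /Fp_embed ?FpM ?modE ?natrM.
pose e : {rmorphism 'F_p -> K} := HB.pack (@Fp_embed K p)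
  (GRing.isNmodMorphism.Build _ _ _ addE)
  (GRing.isMonoidMorphism.Build _ _ _ mulE).
by exists e.
Qed.

Lemma algebraicOver_comp (F K E : fieldType) (e : {rmorphism F -> K})
    (i : {rmorphism K -> E}) (t : K) :
  algebraicOver (i \o e) (i t) -> algebraicOver e t.
Proof. by move=> [q q_neq0]; rewrite map_poly_comp fmorph_root; exists q. Qed.

(** An irreducible factor of a separable polynomial is separable, hence linear here; its root is
    split off and the separable cofactor is handled by induction. *)
Lemma split_of_irreducible_linear (K : fieldType) :
    (forall f : {poly K}, irreducible_poly f -> separable_poly f ->
      (size f <= 2)%N) ->
  separably_closed K.
Proof.
move=> lin q; have [n] := ubnP (size q); elim: n q => // n IHn q ltqn sep_q.
have q_neq0 := separable_poly_neq0 sep_q.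
have [q_le1|q_gt1] := leqP (size q) 1.
  exists [::]; rewrite big_nil -size_poly_eq1 eqn_leq q_le1.
  by rewrite size_poly_gt0.
have [f irr_f fq] := irreducible_factor _ _ q_gt1.
have size_f : size f = 2%N.
  by apply/eqP; rewrite eqn_leq (irr_f.1) lin //; apply: dvdp_separable sep_q.
have [a ra] : exists a, root f a.
  have [x rx] := poly2_root size_f; by exists x.
have /factor_theorem[r Dr] : root q a.
  by move: ra; rewrite !root_factor_theorem => /dvdp_trans; apply.
move: q_neq0 sep_q ltqn; rewrite Dr separable_root => rX_neq0 /andP[sep_r _].
rewrite size_mulXsubC ?(separable_poly_neq0 sep_r) // ltnS => ltrn.
have [s Ds] := IHn r ltrn sep_r.
by exists (a :: s); rewrite big_cons mulrC eqp_mull.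
Qed.

Theorem proposition5p1 (K : fieldType) (p : nat) (hp : p \in [pchar K])
    (htr : ~ algebraic_over_Fp K p) :
  separably_closed K <->
  (forall f g : {poly K}, irreducible_poly f -> irreducible_poly g ->
     coprimep f g ->
     @G0 {poly K} `<=` P_closure (principal_ideal f) (pow g)).
Proof.
split=> [scK f g irr_f _ co_fg | H].
  apply: G0_poly_subset_closure => // n.
  have [k [c fgc]] := separably_closed_pow_const _ _ hp f g scK irr_f.
  have pr_p := pcharf_prime hp.
  (* Raising the congruence modulo [f] to the power [p ^ n] gives one modulo [f ^+ (p ^ n)], and
     [n < p ^ n]. *)
  exists (p ^ (k + n))%N, (c ^+ (p ^ n)); split; first by rewrite expn_gt0 prime_gt0.
  have pn : [pchar {poly K}].-nat (p ^ n)%N by rewrite pnatX pnatE // pchar_poly hp.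
  have -> : g ^+ (p ^ (k + n)) - (c ^+ (p ^ n))%:P = (g ^+ (p ^ k) - c%:P) ^+ (p ^ n).
    by rewrite exprDn_pchar // exprNn_pchar // expnD exprM rmorphXn.
  apply: (@dvdp_trans _ (f ^+ (p ^ n))); last exact: dvdp_exp2r.
  by rewrite dvdp_exp2l // ltnW // ltn_expl // prime_gt1.
apply: split_of_irreducible_linear => f irr_f sep_f.
rewrite leqNgt; apply/negP=> f_gt2; apply: htr => t.
have [e De] := Fp_embed_rmorphism _ _ hp.
have [E [i [a [b [neq_ab ra rb]]]]] :=
  irreducible_separable_two_roots _ _ irr_f sep_f f_gt2.
suff [q q_neq0 rq] : algebraicOver e t.
  by exists q => //; rewrite (eq_map_poly De).
apply: algebraicOver_comp; apply: algebraic_of_shifted_powers neq_ab _ => s s01t.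
have [s' ->] : exists s', s = i s'.
  move: s01t; rewrite !inE => /or3P[] /eqP->; last by exists t.
    by exists 0; rewrite rmorph0.
  by exists 1; rewrite rmorph1.
(* Since [f] has degree at least two, it cannot divide a linear polynomial. *)
have co_fX : coprimep f ('X - s'%:P).
  rewrite irreducible_poly_coprime //; apply: contraTN f_gt2.
  by move=> /dvdp_leq; rewrite polyXsubC_eq0 size_XsubC -leqNgt => ->.
have [m [c [m_gt0 fXc]]] :=
  closure_pow_const _ _ _ (H _ _ irr_f (irredp_XsubC s') co_fX).
(* Evaluating the congruence at a root of [f] gives a value independent of the root, so [a] and [b]
   yield the same power. *)
have powE r : root (map_poly i f) r -> (r - i s') ^+ m = i c.
  move: fXc; rewrite -(dvdp_map i) => /dvdpP[h Dh] /rootP r0.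
  have /(congr1 (horner^~ r)) := Dh.
  rewrite hornerM r0 mulr0 rmorphB rmorphXn rmorphB /= map_polyX !map_polyC /= !hornerE.
  by move/eqP; rewrite subr_eq0 => /eqP.
by exists m => //; rewrite !powE.
Qed.
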